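(* There is a setwise bijection between right-angled Artin groups up to isomorphism and their cohomology rings up to isomorphism, given by $G(\Delta)\mapsto H^*(G(\Delta);\mathbb{Z}/2\mathbb{Z})$. That is, for finite simple graphs $\Delta$ and $\Delta'$, the groups $G(\Delta)$ and $G(\Delta')$ are isomorphic if and only if the rings $H^*(G(\Delta);\mathbb{Z}/2\mathbb{Z})$ and $H^*(G(\Delta');\mathbb{Z}/2\mathbb{Z})$ are isomorphic.
   Context: For a finite simple graph $\Delta$ (no loops or multiple edges), the right-angled Artin group $G(\Delta)$ is the group generated by the vertices of $\Delta$, subject only to the relations that two generators commute whenever the corresponding vertices are joined by an edge. Cohomology is group cohomology with coefficients in $\mathbb{Z}/2\mathbb{Z}$, with the ring structure given by cup product. *)

(* Defs.v *)
From HB Require Import structures.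
From mathcomp Require Import all_boot all_order all_algebra.
From mathcomp Require Import boolp functions ring zify.

Set Implicit Arguments.
Unset Strict Implicit.
Unset Printing Implicit Defensive.

Import GRing.Theory.

Local Open Scope ring_scope.
Local Open Scope quotient_scope.

(* Words in the letters v (encoded (v, true)) and v^-1 (encoded (v, false)). *)
Definition word (V : finType) := seq (V * bool).

(* The least congruence of the word monoid that makes (v, ~~ b) inverse to
   (v, b) and adjacent vertices commute: words modulo raag_cong E form the group
   < V | v w = w v whenever E v w >. *)
Inductive raag_cong (V : finType) (E : rel V) : word V -> word V -> Prop :=
| RaagRefl u : raag_cong E u u
| RaagSym u w : raag_cong E u w -> raag_cong E w u
| RaagTrans w u z : raag_cong E u w -> raag_cong E w z -> raag_cong E u z
| RaagCat u u' w w' :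
    raag_cong E u u' -> raag_cong E w w' -> raag_cong E (u ++ w) (u' ++ w')
| RaagInv v b : raag_cong E [:: (v, b); (v, ~~ b)] [::]
| RaagComm v w : E v w ->
    raag_cong E [:: (v, true); (w, true)] [:: (w, true); (v, true)].

Section Raag.
Variables (V : finType) (E : rel V).
Implicit Types u w z : word V.

Definition raag_congb u w : bool := `[< raag_cong E u w >].

Lemma raag_congb_refl : reflexive raag_congb.
Proof. by move=> u; apply/asboolP/RaagRefl. Qed.

Lemma raag_congb_sym : symmetric raag_congb.
Proof. by move=> u w; apply/asboolP/asboolP => /RaagSym. Qed.

Lemma raag_congb_trans : transitive raag_congb.
Proof.
by move=> w u z /asboolP uw /asboolP wz; apply/asboolP/(RaagTrans uw wz).
Qed.

Canonical raag_equiv :=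
  EquivRel raag_congb raag_congb_refl raag_congb_sym raag_congb_trans.

Definition raag := {eq_quot raag_equiv}.
HB.instance Definition _ := Choice.on raag.
HB.instance Definition _ := EqQuotient.on raag.

Lemma raag_eqP u w : (\pi_raag u = \pi_raag w) <-> raag_cong E u w.
Proof. by split=> [/eqmodP/asboolP //|uw]; apply/eqmodP/asboolP. Qed.

Definition word_inv u : word V := rev [seq (x.1, ~~ x.2) | x <- u].

Lemma raag_cong_invl u : raag_cong E (word_inv u ++ u) [::].
Proof.
elim: u => [|[v b] u IHu]; first exact: RaagRefl.
rewrite /word_inv /= rev_cons cat_rcons -[_ :: _ :: _]/([:: _; _] ++ _).
apply: RaagTrans IHu; apply: RaagCat; first exact: RaagRefl.
rewrite -{2}[u]cat0s; apply: RaagCat; last exact: RaagRefl.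
by rewrite -{2}[b]negbK; apply: RaagInv.
Qed.

Lemma word_invK : involutive word_inv.
Proof.
move=> u; rewrite /word_inv map_rev revK -map_comp -[RHS]map_id.
by apply: eq_map => -[v b] /=; rewrite negbK.
Qed.

Lemma raag_cong_invr u : raag_cong E (u ++ word_inv u) [::].
Proof. by rewrite -{1}[u]word_invK; apply: raag_cong_invl. Qed.

Lemma raag_cong_inv u w : raag_cong E u w ->
  raag_cong E (word_inv u) (word_inv w).
Proof.
move=> uw; apply: (@RaagTrans _ _ (word_inv u ++ (w ++ word_inv w))).
  rewrite -{1}[word_inv u]cats0; apply: RaagCat; first exact: RaagRefl.
  exact/RaagSym/raag_cong_invr.
rewrite catA -{2}[word_inv w]cat0s; apply: RaagCat; last exact: RaagRefl.
apply: RaagTrans (raag_cong_invl u); apply: RaagCat; first exact: RaagRefl.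
exact: RaagSym.
Qed.

Definition raag_one : raag := \pi_raag [::].
Definition raag_mul (x y : raag) : raag := \pi_raag (repr x ++ repr y).
Definition raag_inv (x : raag) : raag := \pi_raag (word_inv (repr x)).

Lemma raag_cong_repr u : raag_cong E (repr (\pi_raag u)) u.
Proof. by apply/raag_eqP; rewrite reprK. Qed.

Lemma raag_mul_pi u w : raag_mul (\pi_raag u) (\pi_raag w) = \pi_raag (u ++ w).
Proof. by apply/raag_eqP; apply: RaagCat; apply: raag_cong_repr. Qed.

Lemma raag_inv_pi u : raag_inv (\pi_raag u) = \pi_raag (word_inv u).
Proof. by apply/raag_eqP; apply: raag_cong_inv; apply: raag_cong_repr. Qed.

Lemma raag_mulA : associative raag_mul.
Proof.
elim/quotW=> u; elim/quotW=> w; elim/quotW=> z.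
by rewrite (raag_mul_pi w z) (raag_mul_pi u w) !raag_mul_pi catA.
Qed.

Lemma raag_mul1 : left_id raag_one raag_mul.
Proof. by elim/quotW=> u; apply: raag_mul_pi. Qed.

Lemma raag_mulr1 : right_id raag_one raag_mul.
Proof. by elim/quotW=> u; rewrite raag_mul_pi cats0. Qed.

Lemma raag_mulV : left_inverse raag_one raag_inv raag_mul.
Proof.
elim/quotW=> u; rewrite raag_inv_pi raag_mul_pi.
by apply/raag_eqP; apply: raag_cong_invl.
Qed.

Lemma raag_mulrV : right_inverse raag_one raag_inv raag_mul.
Proof.
elim/quotW=> u; rewrite raag_inv_pi raag_mul_pi.
by apply/raag_eqP; apply: raag_cong_invr.
Qed.

HB.instance Definition _ :=
  isGroup.Build raag raag_mulA raag_mul1 raag_mulr1 raag_mulV raag_mulrV.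

End Raag.

(* Inhomogeneous cochains of a discrete group G with trivial coefficients F_2.
   A function h : seq G -> 'F_2 is a family of functions h_n : G^n -> F_2, the
   restrictions of h to sequences of size n; the families with h_n = 0 for all
   large n form the direct sum over n of the groups C^n(G; F_2). *)
Section BarComplex.
Variable G : groupType.
Implicit Types (f g h : seq G -> 'F_2) (s : seq G).

(* [:: g_1; ...; g_(i+1) * g_(i+2); ...; g_n] for s = [:: g_1; ...; g_n]. *)
Definition bar_merge (i : nat) s : seq G :=
  take i s ++ (nth 1%g s i * nth 1%g s i.+1)%g :: drop i.+2 s.

(* The signs of the usual formula are omitted: 1 = -1 in F_2. There is nothing
   in degree 0, where the value is that of a coboundary. *)
Definition bar_diff h s : 'F_2 :=
  if s is x :: s' then
    h s' + \sum_(i < size s') h (bar_merge i s) + h (belast x s')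
  else 0.

Definition bar_cup f g s : 'F_2 :=
  \sum_(i < (size s).+1) f (take i s) * g (drop i s).

Definition bar_one s : 'F_2 := (nilp s)%:R.

Definition bar_bounded h := exists n, forall s, (n <= size s)%N -> h s = 0.

Local Notation "h ~_ x" := (fun s => h (x :: s)) (at level 2, format "h ~_ x").

Lemma F2_addxx (a : 'F_2) : a + a = 0.
Proof. exact/addrr_pchar2/pchar_Fp. Qed.

Lemma F2_two : 2%:R = 0 :> 'F_2.
Proof. exact: val_inj. Qed.

Lemma F2_four : 4%:R = 0 :> 'F_2.
Proof. exact: val_inj. Qed.

Lemma bar_diff1 h x : bar_diff h [:: x] = 0.
Proof. by rewrite /bar_diff big_ord0 addr0 F2_addxx. Qed.

Lemma bar_diff_cons h x y s : bar_diff h [:: x, y & s] =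
  h (y :: s) + h ((x * y)%g :: s) + h (x :: s) + bar_diff h~_x (y :: s).
Proof.
rewrite /bar_diff /= big_ord_recl /= {1}/bar_merge /= drop0.
under eq_bigr => i _ do rewrite {1}/bar_merge /=.
under [X in _ = _ + (_ + X + _)]eq_bigr => i _ do rewrite /bar_merge /=.
set A := \sum_(i < _) _; rewrite -!addrA; congr (_ + (_ + _)).
by rewrite [RHS]addrA F2_addxx add0r.
Qed.

Lemma bar_cup_nil f g : bar_cup f g [::] = f [::] * g [::].
Proof. by rewrite /bar_cup big_ord1. Qed.

Lemma bar_cup_cons f g x s :
  bar_cup f g (x :: s) = f [::] * g (x :: s) + bar_cup f~_x g s.
Proof. by rewrite /bar_cup big_ord_recl /=. Qed.

Lemma bar_cupE f g f' g' : f =1 f' -> g =1 g' -> bar_cup f g =1 bar_cup f' g'.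
Proof. by move=> ff gg s; apply: eq_bigr => i _; rewrite ff gg. Qed.

Lemma bar_cupDl f f' g s :
  bar_cup (fun t => f t + f' t) g s = bar_cup f g s + bar_cup f' g s.
Proof. by rewrite -big_split; apply: eq_bigr => i _; rewrite mulrDl. Qed.

Lemma bar_cupDr f g g' s :
  bar_cup f (fun t => g t + g' t) s = bar_cup f g s + bar_cup f g' s.
Proof. by rewrite -big_split; apply: eq_bigr => i _; rewrite mulrDr. Qed.

Lemma bar_cupZl a f g s : bar_cup (fun t => a * f t) g s = a * bar_cup f g s.
Proof. by rewrite /bar_cup big_distrr; apply: eq_bigr => i _; rewrite /= mulrA. Qed.

Lemma bar_cupA f g h : bar_cup f (bar_cup g h) =1 bar_cup (bar_cup f g) h.
Proof.
move=> s; elim: s f g h => [|x s IHs] f g h.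
  by rewrite !bar_cup_nil mulrA.
have hd t : (bar_cup f g)~_x t = f [::] * g~_x t + bar_cup f~_x g t.
  exact: bar_cup_cons.
rewrite !bar_cup_cons bar_cup_nil IHs (bar_cupE hd (frefl h)).
by rewrite bar_cupDl bar_cupZl mulrDr mulrA addrA.
Qed.

Lemma bar_cup1l f : bar_cup bar_one f =1 f.
Proof.
case=> [|x s]; first by rewrite bar_cup_nil mul1r.
rewrite bar_cup_cons mul1r /bar_cup big1 ?addr0 // => i _.
by rewrite /bar_one mul0r.
Qed.

Lemma bar_cup1r f : bar_cup f bar_one =1 f.
Proof.
move=> s; elim: s f => [|x s IHs] f; first by rewrite bar_cup_nil mulr1.
by rewrite bar_cup_cons mulr0 add0r IHs.
Qed.

Lemma bar_diffE h h' : h =1 h' -> bar_diff h =1 bar_diff h'.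
Proof.
by move=> hh [|x s] //=; rewrite !hh; under eq_bigr => i _ do rewrite hh.
Qed.

Lemma bar_diffD h h' s :
  bar_diff (fun t => h t + h' t) s = bar_diff h s + bar_diff h' s.
Proof.
case: s => [|x s] /=; first by rewrite addr0.
by rewrite big_split /=; ring.
Qed.

Lemma bar_diffZ a h s : bar_diff (fun t => a * h t) s = a * bar_diff h s.
Proof.
case: s => [|x s] /=; first by rewrite mulr0.
by rewrite -big_distrr /= !mulrDr.
Qed.

Local Arguments bar_diff : simpl never.

Let mulhd h x : seq G -> 'F_2 :=
  fun t => if t is y :: t' then h ((x * y)%g :: t') else h [::].
Let delhd h x : seq G -> 'F_2 :=
  fun t => if t is y :: t' then h (x :: t') else 0.

Let bar_diff_hd h x t : (bar_diff h)~_x t =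
  h t + mulhd h x t + delhd h x t + bar_diff h~_x t.
Proof.
by case: t => [|y t]; [rewrite bar_diff1 /= !addr0 F2_addxx | exact: bar_diff_cons].
Qed.

Lemma bar_diff_diff h s : bar_diff (bar_diff h) s = 0.
Proof.
elim: s h => [//|x [|y s] IHs] h; first exact: bar_diff1.
rewrite bar_diff_cons (bar_diffE (bar_diff_hd h x)) !bar_diffD IHs addr0.
case: s {IHs} => [|z s]; first by rewrite !bar_diff1 !addr0.
rewrite !bar_diff_cons /mulhd /delhd [LHS]/= !mulgA. ring: F2_four F2_two.
Qed.

Lemma bar_diff_cup f g s :
  bar_diff (bar_cup f g) s = bar_cup (bar_diff f) g s + bar_cup f (bar_diff g) s.
Proof.
elim: s f g => [|x [|y s] IHs] f g.
- by rewrite !bar_cup_nil mul0r mulr0 addr0.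
- by rewrite bar_diff1 !bar_cup_cons !bar_cup_nil /bar_diff /= !big_ord0; ring: F2_four F2_two.
have hd t : (bar_cup f g)~_x t = f [::] * g~_x t + bar_cup f~_x g t.
  exact: bar_cup_cons.
rewrite bar_diff_cons (bar_diffE hd) bar_diffD bar_diffZ IHs.
rewrite (bar_cup_cons (bar_diff f)) (bar_cup_cons f (bar_diff g)) mul0r add0r.
rewrite (bar_cupE (bar_diff_hd f x) (frefl g)) !bar_cupDl bar_diff_cons.
rewrite !(bar_cup_cons _ _ _ s) /=.
have E : 0 = 2%:R * (f [::] * g (y :: s)) by rewrite F2_two mul0r.
by rewrite -[LHS]addr0 [X in _ + X = _]E; ring.
Qed.

Lemma bar_bounded0 : bar_bounded (fun=> 0).
Proof. by exists 0. Qed.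

Lemma bar_boundedB f g :
  bar_bounded f -> bar_bounded g -> bar_bounded (fun s => f s - g s).
Proof.
move=> [m fP] [n gP]; exists (m + n)%N => s le_s.
by rewrite fP ?gP ?subr0 // (leq_trans _ le_s) ?leq_addl ?leq_addr.
Qed.

Lemma bar_bounded_one : bar_bounded bar_one.
Proof. by exists 1 => -[]. Qed.

Lemma size_bar_merge i s : (i.+1 < size s)%N -> size (bar_merge i s) = (size s).-1.
Proof.
move=> lt_i; rewrite size_cat /= size_drop size_takel; last exact: ltnW (ltnW _).
lia.
Qed.

Lemma bar_bounded_diff h : bar_bounded h -> bar_bounded (bar_diff h).
Proof.
move=> [n hP]; exists n.+1 => -[//|x s]; rewrite /= ltnS /bar_diff => le_s.
rewrite !hP ?size_belast // big1 ?addr0 // => i _.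
by rewrite hP // size_bar_merge //= ltnS.
Qed.

Lemma bar_bounded_cup f g :
  bar_bounded f -> bar_bounded g -> bar_bounded (bar_cup f g).
Proof.
move=> [m fP] [n gP]; exists (m + n)%N => s le_s; apply: big1 => i _.
have le_i : (i <= size s)%N by rewrite -ltnS.
have [le_m|lt_m] := leqP m i; first by rewrite fP ?mul0r ?size_takel.
by rewrite gP ?mulr0 // size_drop; lia.
Qed.

Definition cochain_pred : {pred seq G -> 'F_2} := fun h => `[< bar_bounded h >].

Lemma cochain_zmod_closed : zmod_closed cochain_pred.
Proof.
split=> [|f g /asboolP fP /asboolP gP]; apply/asboolP.
  exact: bar_bounded0.
exact: bar_boundedB.
Qed.

HB.instance Definition _ :=
  GRing.isZmodClosed.Build _ cochain_pred cochain_zmod_closed.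

(* The direct sum over n of the groups C^n(G; F_2). *)
Record cochain := Cochain {
  cochain_val :> seq G -> 'F_2;
  cochain_valP : cochain_val \in cochain_pred
}.

HB.instance Definition _ := [isSub for cochain_val].
HB.instance Definition _ := [Choice of cochain by <:].
HB.instance Definition _ := [SubChoice_isSubZmodule of cochain by <:].

Implicit Types a b c : cochain.

Lemma cochainP a b : a =1 b -> a = b.
Proof. by move=> ab; apply/val_inj/funext. Qed.

Lemma cochain_bounded a : bar_bounded a.
Proof. exact/asboolP/cochain_valP. Qed.

Definition cochain_one : cochain := Cochain (asboolT bar_bounded_one).

Definition cochain_mul a b : cochain :=
  Cochain (asboolT (bar_bounded_cup (cochain_bounded a) (cochain_bounded b))).

Definition codiff a : cochain :=
  Cochain (asboolT (bar_bounded_diff (cochain_bounded a))).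

Lemma cochain_mulA : associative cochain_mul.
Proof. by move=> a b c; apply/cochainP/bar_cupA. Qed.

Lemma cochain_mul1 : left_id cochain_one cochain_mul.
Proof. by move=> a; apply/cochainP/bar_cup1l. Qed.

Lemma cochain_mulr1 : right_id cochain_one cochain_mul.
Proof. by move=> a; apply/cochainP/bar_cup1r. Qed.

Lemma cochain_mulDl : left_distributive cochain_mul +%R.
Proof. by move=> a b c; apply: cochainP => s; apply: bar_cupDl. Qed.

Lemma cochain_mulDr : right_distributive cochain_mul +%R.
Proof. by move=> a b c; apply: cochainP => s; apply: bar_cupDr. Qed.

Lemma cochain_one_neq0 : cochain_one != 0.
Proof. by apply/eqP => /(congr1 (fun a : cochain => a [::])). Qed.

(* The product is the cup product. *)
HB.instance Definition _ := GRing.Zmodule_isNzRing.Build cochain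
  cochain_mulA cochain_mul1 cochain_mulr1 cochain_mulDl cochain_mulDr
  cochain_one_neq0.

Lemma codiff_is_zmod_morphism : zmod_morphism codiff.
Proof.
move=> a b; apply: cochainP => s; rewrite /= -[RHS]/(_ s - _ s) /=.
have E : a - b =1 (fun t => a t + (-1) * b t) by move=> t; rewrite mulN1r.
by rewrite (bar_diffE E) bar_diffD bar_diffZ mulN1r.
Qed.

HB.instance Definition _ :=
  GRing.isZmodMorphism.Build cochain cochain codiff codiff_is_zmod_morphism.

Lemma codiffK a : codiff (codiff a) = 0.
Proof. by apply: cochainP => s; apply: bar_diff_diff. Qed.

Lemma codiffM a b : codiff (a * b) = codiff a * b + a * codiff b.
Proof. by apply: cochainP => s; apply: bar_diff_cup. Qed.

Lemma codiff1 : codiff 1 = 0.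
Proof.
have := codiffM 1 1; rewrite !mulr1 mul1r => E.
by apply: (addrI (codiff 1)); rewrite addr0 -E.
Qed.

Definition cocycle_pred : {pred cochain} := fun a => codiff a == 0.

Lemma cocycle_subring_closed : subring_closed cocycle_pred.
Proof.
split=> [|a b /eqP da /eqP db|a b /eqP da /eqP db]; apply/eqP.
- exact: codiff1.
- by rewrite raddfB /= da db subr0.
- by rewrite codiffM da db mul0r mulr0 addr0.
Qed.

HB.instance Definition _ :=
  GRing.isSubringClosed.Build cochain cocycle_pred cocycle_subring_closed.

Record cocycle := Cocycle {
  cocycle_val :> cochain;
  cocycle_valP : cocycle_val \in cocycle_pred
}.

HB.instance Definition _ := [isSub for cocycle_val].
HB.instance Definition _ := [Choice of cocycle by <:].
HB.instance Definition _ := [SubChoice_isSubNzRing of cocycle by <:].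

Implicit Types y z t : cocycle.

Lemma codiff_cocycle z : codiff (val z) = 0.
Proof. exact/eqP/cocycle_valP. Qed.

Definition coboundary_pred : {pred cocycle} :=
  fun z => `[< exists a : cochain, val z = codiff a >].

Lemma coboundary_zmod_closed : zmod_closed coboundary_pred.
Proof.
split=> [|y z /asboolP[a ya] /asboolP[b zb]]; apply/asboolP.
  by exists 0; rewrite !raddf0.
by exists (a - b); rewrite !raddfB /= ya zb.
Qed.

HB.instance Definition _ :=
  GRing.isZmodClosed.Build cocycle coboundary_pred coboundary_zmod_closed.

Lemma coboundaryMl y z : z \in coboundary_pred -> y * z \in coboundary_pred.
Proof.
move=> /asboolP[a za]; apply/asboolP; exists (val y * a).
by rewrite codiffM codiff_cocycle mul0r add0r rmorphM /= za.
Qed.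

Lemma coboundaryMr y z : y \in coboundary_pred -> y * z \in coboundary_pred.
Proof.
move=> /asboolP[a ya]; apply/asboolP; exists (a * val z).
by rewrite codiffM codiff_cocycle mulr0 addr0 rmorphM /= ya.
Qed.

Lemma coboundary1 : 1 \notin coboundary_pred.
Proof.
by apply/asboolP => -[a] /(congr1 (fun b : cochain => b [::])).
Qed.

(* H^*(G; F_2), the direct sum of all H^n(G; F_2): the differential raises the
   degree by one, so cohomology commutes with the direct sum over degrees. *)
Definition cohomology := {ideal_quot coboundary_pred}.
HB.instance Definition _ := EqQuotient.on cohomology.
HB.instance Definition _ := GRing.Zmodule.on cohomology.

Lemma cohomology_eqP y z :
  (\pi_cohomology y = \pi_cohomology z) <-> y - z \in coboundary_pred.
Proof. by rewrite Quotient.idealrBE; split=> [->|/eqP]. Qed.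

Definition cohomology_one : cohomology := \pi_cohomology 1.
Definition cohomology_mul (x x' : cohomology) : cohomology :=
  \pi_cohomology (repr x * repr x').

Lemma cohomology_mul_pi y z :
  cohomology_mul (\pi_cohomology y) (\pi_cohomology z) = \pi_cohomology (y * z).
Proof.
apply/cohomology_eqP; set y' := repr _; set z' := repr _.
have yP : y' - y \in coboundary_pred by apply/cohomology_eqP; rewrite reprK.
have zP : z' - z \in coboundary_pred by apply/cohomology_eqP; rewrite reprK.
have -> : y' * z' - y * z = (y' - y) * z' + y * (z' - z).
  by rewrite mulrBl mulrBr addrA subrK.
by apply: rpredD; [exact: coboundaryMr | exact: coboundaryMl].
Qed.

Lemma cohomology_add_pi y z :
  \pi_cohomology y + \pi_cohomology z = \pi_cohomology (y + z).
Proof. by rewrite piE. Qed.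

Lemma cohomology_mulA : associative cohomology_mul.
Proof.
elim/quotW=> y; elim/quotW=> z; elim/quotW=> t.
by rewrite (cohomology_mul_pi z t) (cohomology_mul_pi y z)
  !cohomology_mul_pi mulrA.
Qed.

Lemma cohomology_mul1 : left_id cohomology_one cohomology_mul.
Proof. by elim/quotW=> z; rewrite cohomology_mul_pi mul1r. Qed.

Lemma cohomology_mulr1 : right_id cohomology_one cohomology_mul.
Proof. by elim/quotW=> z; rewrite cohomology_mul_pi mulr1. Qed.

Lemma cohomology_mulDl : left_distributive cohomology_mul +%R.
Proof.
elim/quotW=> y; elim/quotW=> z; elim/quotW=> t.
by rewrite cohomology_add_pi !cohomology_mul_pi cohomology_add_pi mulrDl.
Qed.

Lemma cohomology_mulDr : right_distributive cohomology_mul +%R.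
Proof.
elim/quotW=> y; elim/quotW=> z; elim/quotW=> t.
by rewrite cohomology_add_pi !cohomology_mul_pi cohomology_add_pi mulrDr.
Qed.

Lemma cohomology_one_neq0 : cohomology_one != 0.
Proof.
apply: contra coboundary1 => /eqP; rewrite /cohomology_one -[1]subr0.
move=> h; apply/cohomology_eqP; rewrite -[1]subr0 h; by rewrite piE.
Qed.

HB.instance Definition _ := GRing.Zmodule_isNzRing.Build cohomology
  cohomology_mulA cohomology_mul1 cohomology_mulr1 cohomology_mulDl
  cohomology_mulDr cohomology_one_neq0.

End BarComplex.

Definition group_isomorphic (G H : groupType) : Prop :=
  exists f : {multiplicative G -> H}, bijective f.

Definition ring_isomorphic (R S : nzRingType) : Prop :=
  exists f : {rmorphism R -> S}, bijective f.

(* Main.v *)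
Require Import Defs.
From HB Require Import structures.
From mathcomp Require Import all_boot all_order all_algebra.
From mathcomp Require Import perm boolp ring.

(* The ring H = H^*(G(Delta); F_2) is generated by H^1 = F_2^V.  This is proved
   by adding the vertices one at a time: the cochains of G(Delta) form a
   filtration by invariance under fewer and fewer generators, and consecutive
   steps differ by the cochains attached to the link of the added vertex.  The
   classes a, b in F_2^V have product zero iff a_v b_w = a_w b_v on every edge
   vw.  Since H is generated in degree one, a ring isomorphism, graded or not,
   induces a linear isomorphism f of degree one parts preserving the relation
   "ab = 0".  The number of b with b v = 0 is 2^c(v), c(v) being the number of
   vertices not adjacent to v (including v).  A nonzero term in the expansion
   of the determinant of f is a bijection p of the vertices with p(v) in the
   support of f(v), and comparing the numbers c(v) shows that p is an
   isomorphism of graphs. *)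

Set Implicit Arguments.
Unset Strict Implicit.
Unset Printing Implicit Defensive.

Import GRing.Theory.
Local Open Scope ring_scope.
Local Open Scope quotient_scope.

(** * Linear maps preserving the vanishing of products *)

Lemma F2_neq0 (x : 'F_2) : x != 0 -> x = 1.
Proof. by case: x => [[|[|//]] ltx] // _; apply: val_inj. Qed.

Lemma F2_oppr (x : 'F_2) : - x = x.
Proof. exact/oppr_pchar2/pchar_Fp. Qed.

(** If every permutation met a zero entry of [A], each term of the Leibniz formula would vanish and
    the determinant of [A] would not be invertible. *)
Lemma invertible_matching (F : fieldType) m n (A : 'M[F]_(m, n)) (B : 'M_(n, m)) :
  A *m B = 1%:M -> B *m A = 1%:M ->
  exists2 s : 'I_m -> 'I_n, injective s & forall i, A i (s i) != 0.
Proof.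
move=> AB BA; have eq_mn : m = n.
  by apply/eqP; rewrite eqn_leq (mulmx1_min AB) (mulmx1_min BA).
subst n; have [|] := boolP [exists s : 'S_m, [forall i, A i (s i) != 0]].
  move=> /existsP[s /forallP sP]; exists s => //; exact: perm_inj.
move=> /existsPn noS; have /(congr1 determinant) := AB.
rewrite det_mulmx det1 {1}/determinant big1 ?mul0r => [/eqP|s _].
  by rewrite eq_sym oner_eq0.
have /forallPn[i /negbNE/eqP Ai] := noS s.
by rewrite (bigD1 i) //= Ai mul0r mulr0.
Qed.

Section Delta.
Variable V : finType.

Definition delta (v : V) : {ffun V -> 'F_2} := [ffun w => (w == v)%:R].

Lemma ffun_delta_sum (a : {ffun V -> 'F_2}) : a = \sum_v delta v *+ a v.
Proof.
apply/ffunP => w; rewrite sum_ffunE (bigD1 w) //= big1 ?addr0 => [|v ne_vw].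
  by rewrite ffunMnE ffunE eqxx natr_Zp.
by rewrite ffunMnE ffunE eq_sym (negPf ne_vw) mul0rn.
Qed.

(** Additive maps between these spaces are linear, every scalar of F_2 being the image of a natural
    number. *)
Lemma ffun_delta_expand (V' : finType)
    (f : {additive {ffun V -> 'F_2} -> {ffun V' -> 'F_2}}) a w :
  f a w = \sum_v a v * f (delta v) w.
Proof.
rewrite {1}[a]ffun_delta_sum raddf_sum sum_ffunE; apply: eq_bigr => v _.
by rewrite raddfMn ffunMnE -mulr_natl natr_Zp.
Qed.

End Delta.

(** * Counting the vectors perpendicular to a given one *)

Section Perp.
Variables (V : finType) (E : rel V).
Hypotheses (E_sym : symmetric E) (E_irr : irreflexive E).
Implicit Types (u v w x : V) (a b : {ffun V -> 'F_2}).

(* On degree one classes this is the relation "the cup product vanishes". *)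
Definition perp a b := [forall v, forall w, E v w ==> (a v * b w == a w * b v)].

Lemma perpP a b :
  reflect (forall v w, E v w -> a v * b w = a w * b v) (perp a b).
Proof.
apply: (iffP forallP) => [h v w vw|h v].
  by have /forallP/(_ w)/implyP/(_ vw)/eqP := h v.
by apply/forallP => w; apply/implyP => vw; rewrite h.
Qed.

Lemma perp_refl a : perp a a.
Proof. by apply/perpP => v w _; rewrite mulrC. Qed.

Lemma perp_delta v b : perp (delta v) b = [forall w, E v w ==> (b w == 0)].
Proof.
apply/perpP/forallP => [h w|h x w xw].
  apply/implyP => vw; have := h v w vw; rewrite !ffunE eqxx mul1r => bw.
  apply/eqP; rewrite bw; case: eqP vw => [->|_ _]; first by rewrite E_irr.
  by rewrite mul0r.
rewrite !ffunE; have [eq_xv|_] := eqVneq x v; have [eq_wv|_] := eqVneq w v;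
  rewrite ?mul0r ?mul1r //.
- by rewrite eq_xv eq_wv.
- by apply/eqP; have := h w; rewrite -eq_xv xw.
- by apply/esym/eqP; have := h x; rewrite -eq_wv E_sym xw.
Qed.

Definition codeg v := #|[pred w | ~~ E v w]|.

Definition perpset a : {set {ffun V -> 'F_2}} := [set b | perp a b].

Lemma card_perpset_delta v : #|perpset (delta v)| = (2 ^ codeg v)%N.
Proof.
transitivity (#|predT : pred 'F_2| ^ codeg v)%N; last by rewrite card_Fp.
rewrite -(card_pffun_on (0 : 'F_2)); apply: eq_card => b; rewrite inE perp_delta.
apply/forallP/pffun_onP => [h|[h _] w].
  split=> [|y _]; last by [].
  apply/subsetP => w; rewrite !inE; apply: contraNN => vw.
  by have := h w; rewrite vw.
apply/implyP => vw; apply: contraTT vw => bw.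
by have /subsetP/(_ w) := h; rewrite !inE; apply.
Qed.

Let restr u b : {ffun V -> 'F_2} := [ffun w => if E u w then 0 else b w].

Let restr_perp u b : perp (delta u) (restr u b).
Proof. by rewrite perp_delta; apply/forallP => w; rewrite ffunE; case: (E u w). Qed.

Let perp_nbr a b u w : a u != 0 -> perp a b -> E u w -> b w = a w * b u.
Proof. by move=> /F2_neq0 au /perpP/(_ u w) h uw; rewrite -h // au mul1r. Qed.

(** Since [a u = 1], perpendicularity on an edge [u w] recovers [b w] from [b u], and restriction
    keeps [b u] because [u] is not its own neighbour. *)
Let restr_inj a u : a u != 0 -> {in perpset a &, injective (restr u)}.
Proof.
move=> au b b'; rewrite !inE => ab ab' /ffunP eq_r.
have eqb w : ~~ E u w -> b w = b' w.
  by move=> uw; have := eq_r w; rewrite !ffunE (negPf uw).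
apply/ffunP => w; have [uw|] := boolP (E u w); last exact: eqb.
by rewrite (perp_nbr au ab uw) (perp_nbr au ab' uw) eqb // E_irr.
Qed.

Lemma card_perpset_le a u : a u != 0 -> (#|perpset a| <= 2 ^ codeg u)%N.
Proof.
move=> au; rewrite -card_perpset_delta -(card_in_imset (restr_inj au)).
apply/subset_leq_card/subsetP => _ /imsetP[b _ ->]; rewrite inE.
exact: restr_perp.
Qed.

(* If restriction to the non-neighbours of [u] is onto, then every vertex [w]
   not in the star of [u] has [delta w] perpendicular to [a]. *)
Lemma card_perpset_dominated a u x w :
    a u != 0 -> #|perpset a| = (2 ^ codeg u)%N ->
  a x != 0 -> E x w -> (w == u) || E u w.
Proof.
move=> au card_a ax xw; apply: contraT; rewrite negb_or => /andP[ne_wu uw].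
have /eqP/setP/(_ (delta w)): restr u @: perpset a == perpset (delta u).
  rewrite eqEcard (card_in_imset (restr_inj au)) card_a card_perpset_delta.
  rewrite leqnn andbT; apply/subsetP => _ /imsetP[b _ ->]; rewrite inE.
  exact: restr_perp.
rewrite inE perp_delta => h.
have: delta w \in restr u @: perpset a.
  rewrite h; apply/forallP => y; apply/implyP => uy; rewrite ffunE.
  by case: (y =P w) uy uw => [-> -> //|_ _ _]; rewrite eqxx.
move=> /imsetP[b]; rewrite inE => ab /ffunP eq_b.
(* The preimage is [delta w] itself: [b u = 0] because [w != u], so [b] vanishes on all neighbours
   of [u]. The edge [x w] then forces [a x = 0]. *)
have eqb y : b y = delta w y.
  have [uy|uy] := boolP (E u y); last by rewrite eq_b ffunE (negPf uy).
  rewrite (perp_nbr au ab uy); have := eq_b u; rewrite !ffunE E_irr => <-.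
  rewrite eq_sym (negPf ne_wu) mulr0; by case: (y =P w) uy uw => [-> ->|].
have /perpP/(_ _ _ xw) := ab; rewrite !eqb !ffunE eqxx mulr1.
have ne_xw : x != w by apply: contraTneq xw => ->; rewrite E_irr.
by rewrite (negPf ne_xw) mulr0 => ax0; rewrite ax0 eqxx in ax.
Qed.

End Perp.

(** * Linear isomorphisms preserving perpendicularity: supports and codegrees *)

Section Rigidity.
Variables (V V' : finType) (E : rel V) (E' : rel V').
Hypotheses (E_sym : symmetric E) (E_irr : irreflexive E).
Hypotheses (E'_sym : symmetric E') (E'_irr : irreflexive E').
Variables (f : {additive {ffun V -> 'F_2} -> {ffun V' -> 'F_2}})
          (g : {additive {ffun V' -> 'F_2} -> {ffun V -> 'F_2}}).
Hypotheses (fK : cancel f g) (gK : cancel g f).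
Hypothesis f_perp : forall a b, perp E a b -> perp E' (f a) (f b).

Lemma support_matching :
  exists2 p : V -> V', injective p & forall v, f (delta v) (p v) != 0.
Proof.
pose A := \matrix_(i < #|V|, j < #|V'|) f (delta (enum_val i)) (enum_val j).
pose B := \matrix_(i < #|V'|, j < #|V|) g (delta (enum_val i)) (enum_val j).
have AB : A *m B = 1%:M.
  apply/matrixP => i k; rewrite !mxE.
  transitivity (g (f (delta (enum_val i))) (enum_val k)).
    rewrite (ffun_delta_expand g) [RHS](reindex _ (onW_bij _ (enum_val_bij _))) /=.
    by apply: eq_bigr => j _; rewrite !mxE.
  by rewrite fK ffunE (inj_eq enum_val_inj) eq_sym.
have BA : B *m A = 1%:M.
  apply/matrixP => i k; rewrite !mxE.
  transitivity (f (g (delta (enum_val i))) (enum_val k)).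
    rewrite (ffun_delta_expand f) [RHS](reindex _ (onW_bij _ (enum_val_bij _))) /=.
    by apply: eq_bigr => j _; rewrite !mxE.
  by rewrite gK ffunE (inj_eq enum_val_inj) eq_sym.
have [s s_inj sP] := invertible_matching AB BA.
exists (fun v => enum_val (s (enum_rank v))) => [v w /enum_val_inj/s_inj|v].
  exact: enum_rank_inj.
by have := sP (enum_rank v); rewrite mxE enum_rankK.
Qed.

Lemma card_perpset_le_image a : (#|perpset E a| <= #|perpset E' (f a)|)%N.
Proof.
rewrite -(card_imset _ (can_inj fK)); apply/subset_leq_card/subsetP.
by move=> x /imsetP[b]; rewrite !inE => ab ->; apply: f_perp.
Qed.

(** Both codegrees are exponents in a count of perpendicular vectors: [f] embeds those of [delta v]
    into those of [f (delta v)], which number at most [2 ^ codeg E' x]. *)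
Lemma codeg_support v x : f (delta v) x != 0 -> (codeg E v <= codeg E' x)%N.
Proof.
move=> fx; rewrite -(@leq_exp2l 2) // -card_perpset_delta //.
exact: leq_trans (card_perpset_le_image _) (card_perpset_le _ _ fx).
Qed.

End Rigidity.

Section Isomorphism.
Variables (V V' : finType) (E : rel V) (E' : rel V').
Hypotheses (E_sym : symmetric E) (E_irr : irreflexive E).
Hypotheses (E'_sym : symmetric E') (E'_irr : irreflexive E').
Variables (f : {additive {ffun V -> 'F_2} -> {ffun V' -> 'F_2}})
          (g : {additive {ffun V' -> 'F_2} -> {ffun V -> 'F_2}}).
Hypotheses (fK : cancel f g) (gK : cancel g f).
Hypothesis f_perp : forall a b, perp E a b -> perp E' (f a) (f b).
Hypothesis g_perp : forall a b, perp E' a b -> perp E (g a) (g b).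

(** Codegrees cannot drop along the matching given by [f], nor along the one given by [g]. So the
    total codegrees of the two graphs agree, and each inequality along [p] is an equality. *)
Lemma codeg_matching : exists p : V -> V',
  [/\ bijective p, forall v, f (delta v) (p v) != 0
    & forall v, codeg E v = codeg E' (p v)].
Proof.
have [p p_inj pP] := support_matching fK gK.
have [q q_inj qP] := support_matching gK fK.
have p_bij : bijective p by apply: inj_card_bij p_inj (leq_card q q_inj).
have q_bij : bijective q by apply: inj_card_bij q_inj (leq_card p p_inj).
exists p; split=> // v; apply/eqP; move: v; apply/forallP.
have le_p v : predT v ->
    (codeg E v <= codeg E' (p v) ?= iff (codeg E v == codeg E' (p v)))%N.
  split=> //; exact: (codeg_support E_sym E_irr E'_sym E'_irr fK f_perp (pP v)).
have [_ <-] := leqif_sum le_p.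
rewrite eqn_leq leq_sum => [/=|v _]; last by have [] := le_p v isT.
have <- : (\sum_x codeg E' x = \sum_v codeg E' (p v))%N.
  by rewrite (reindex p) //; apply: onW_bij.
rewrite [X in (_ <= X)%N](reindex q) /=; last exact: onW_bij.
apply: leq_sum => v _.
exact: (codeg_support E'_sym E'_irr E_sym E_irr gK g_perp (qP v)).
Qed.

(* Suppose [v] and [w] are not adjacent but [p v] and [p w] are.  Then the images
   of [delta v] and [delta w] both contain [p v] and [p w], which therefore
   dominate each other, and the two images agree in codegree [codeg E v]; so
   [f (delta v + delta w)] only involves vertices of larger codegree, although
   [g] maps those to vertices of codegree larger than [codeg E v]. *)
Lemma matching_nonadjacent (p : V -> V') : injective p ->
    (forall v, f (delta v) (p v) != 0) ->
    (forall v, codeg E v = codeg E' (p v)) ->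
  forall v w, ~~ E v w -> ~~ E' (p v) (p w).
Proof.
move=> p_inj pP p_codeg v w vw; apply/negP => uz.
set u := p v in uz; set z := p w in uz.
have ne_vw : v != w by apply: contraTneq uz => eq_vw; rewrite /u /z eq_vw E'_irr.
have perp_vw : perp E' (f (delta v)) (f (delta w)).
  apply: f_perp; rewrite perp_delta //; apply/forallP => x; apply/implyP => vx.
  by rewrite ffunE; case: (x =P w) vx vw => [-> ->|].
have Fu : f (delta v) u = 1 by apply: F2_neq0.
have Fz : f (delta w) z = 1 by apply: F2_neq0.
(* Perpendicularity on the edge [u z] makes the product of these two values equal to 1. *)
have [vz wu] : f (delta v) z = 1 /\ f (delta w) u = 1.
  have /perpP/(_ _ _ uz) := perp_vw; rewrite Fu Fz mulr1.
  have [->|/F2_neq0->] := eqVneq (f (delta v) z) 0; first by rewrite mul0r => /eqP.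
  by rewrite mul1r => <-.
(* As [y] and [p y] have the same codegree, [f (delta y)] attains the bound of [card_perpset_le] at
   [p y]. *)
have dominated y x t : f (delta y) x != 0 -> E' x t -> (t == p y) || E' (p y) t.
  apply: card_perpset_dominated => //; apply/eqP; rewrite eqn_leq.
  rewrite card_perpset_le //= -p_codeg -card_perpset_delta //.
  exact: card_perpset_le_image fK f_perp _.
have codeg_uz : codeg E' u = codeg E' z.
  apply/eqP; rewrite eqn_leq -{1}p_codeg -{2}p_codeg.
  by rewrite !(codeg_support E_sym E_irr E'_sym E'_irr fK f_perp) ?vz ?wu ?oner_eq0.
(* Applying [g] to [f (delta v + delta w)] gives the value 1 at [v], so some term of the expansion
   at [v] is nonzero. *)
have [x fx gx] : exists2 x, f (delta v + delta w) x != 0 & g (delta x) v != 0.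
  apply: contrapT => noX; have := congr1 (fun a : {ffun V -> 'F_2} => a v)
    (fK (delta v + delta w)).
  rewrite ffun_delta_expand !ffunE eqxx (negPf ne_vw) addr0 big1 => [/eqP|x _].
    by rewrite eq_sym oner_eq0.
  have [->|fx] := eqVneq (f (delta v + delta w) x) 0; first by rewrite mul0r.
  have [->|gx] := eqVneq (g (delta x) v) 0; first by rewrite mulr0.
  by case: noX; exists x.
have le_x := codeg_support E'_sym E'_irr E_sym E_irr gK g_perp gx.
(* the neighbourhood of [x] lies in the star of [t] and has the same size *)
have nbr_eq y t : f (delta y) x != 0 -> codeg E' x = codeg E' (p y) ->
    ~~ E' x (p y) -> E' (p y) t -> E' x t.
  move=> yx eq_x xy yt.
  have sub : [pred t | E' x t] \subset [pred t | E' (p y) t].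
    apply/subsetP => s; rewrite !inE => xs.
    case/orP: (dominated _ _ _ yx xs) => // /eqP eq_s.
    by rewrite -eq_s xs in xy.
  have card_nbr s : (#|[pred t | E' s t]| + codeg E' s = #|V'|)%N.
    by rewrite -(cardC [pred t | E' s t]).
  have /subset_leqif_card := sub.
  case=> _; rewrite -(eqn_add2r (codeg E' x)) {2}eq_x !card_nbr eqxx => /esym.
  by move=> /subsetP/(_ t); rewrite !inE; apply.
have {fx}: f (delta v) x != 0 /\ f (delta w) x = 0 \/
           f (delta w) x != 0 /\ f (delta v) x = 0.
  move: fx; rewrite raddfD ffunE.
  have [->|/F2_neq0->] := eqVneq (f (delta v) x) 0; rewrite ?add0r; first by right.
  have [->|/F2_neq0->] := eqVneq (f (delta w) x) 0; first by left.
  by rewrite F2_addxx eqxx.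
case=> [[vx wx]|[wx vx]].
- have eq_x : codeg E' x = codeg E' u.
    apply/eqP; rewrite eqn_leq -p_codeg le_x /=.
    exact: (codeg_support E_sym E_irr E'_sym E'_irr fK f_perp).
  (* Either [x] is adjacent to [u], or it inherits the neighbour [z] of [u]. On either edge,
     perpendicularity forces [f (delta v) x = 0]. *)
  have [xu|xu] := boolP (E' x u).
    by have /perpP/(_ _ _ xu)/eqP := perp_vw; rewrite wx wu mulr0 mulr1 (negPf vx).
  have xz := nbr_eq v z vx eq_x xu uz.
  by have /perpP/(_ _ _ xz)/eqP := perp_vw; rewrite wx Fz mulr0 mulr1 (negPf vx).
- have eq_x : codeg E' x = codeg E' z.
    apply/eqP; rewrite eqn_leq -{1}codeg_uz -!p_codeg le_x /=.
    exact: (codeg_support E_sym E_irr E'_sym E'_irr fK f_perp).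
  have [xz|xz] := boolP (E' x z).
    have /perpP/(_ _ _ xz)/eqP := perp_vw.
    by rewrite vx vz mul0r mul1r eq_sym (negPf wx).
  have zu : E' z u by rewrite E'_sym.
  have xu := nbr_eq w u wx eq_x xz zu.
  have /perpP/(_ _ _ xu)/eqP := perp_vw.
  by rewrite vx Fu mul0r mul1r eq_sym (negPf wx).
Qed.

(** The non-neighbours of [v] are sent injectively to those of [p v], and equal codegrees make this
    a bijection. *)
Theorem graph_rigidity : exists2 p : V -> V', bijective p &
  forall v w, E' (p v) (p w) = E v w.
Proof.
have [p [p_bij pP p_codeg]] := codeg_matching.
exists p => // v w; apply/negb_inj.
have p_inj := bij_inj p_bij.
have nonadj := matching_nonadjacent p_inj pP p_codeg.
have sub : p @: [set x | ~~ E v x] \subset [set y | ~~ E' (p v) y].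
  by apply/subsetP => y /imsetP[x]; rewrite !inE => vx ->; apply: nonadj.
have eq_img : p @: [set x | ~~ E v x] = [set y | ~~ E' (p v) y].
  apply/eqP; rewrite eqEcard sub card_imset //= !cardsE.
  exact/eq_leq/esym/p_codeg.
have /setP/(_ (p w)) := eq_img.
by rewrite mem_imset // !inE => <-.
Qed.

End Isomorphism.

(** * Right-angled Artin groups *)

Lemma multiplicative1 (G H : groupType) (f : {multiplicative G -> H}) : f 1%g = 1%g.
Proof. by apply: (mulgI (f 1%g)); rewrite -gmulfM !mulg1. Qed.

Lemma multiplicativeV (G H : groupType) (f : {multiplicative G -> H}) g :
  f g^-1%g = (f g)^-1%g.
Proof. by apply/divg1_eq; rewrite invgK -gmulfM mulVg multiplicative1. Qed.

Section RaagGenerators.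
Variables (V : finType) (E : rel V).
Local Notation G := (raag E).
Implicit Types (g h : G) (x y : V).

Definition raag_gen x : G := \pi_(raag E) [:: (x, true)].

Lemma raag_mulE (u w : word V) :
  ((\pi_(raag E) u : G) * \pi_(raag E) w)%g = \pi_(raag E) (u ++ w) :> G.
Proof. exact: raag_mul_pi. Qed.

Lemma raag_gen_comm x y : E x y -> commute (raag_gen x) (raag_gen y).
Proof.
by move=> xy; rewrite /commute !raag_mulE; apply/raag_eqP/RaagComm.
Qed.

Lemma raag_gen_inv x : (raag_gen x)^-1%g = \pi_(raag E) [:: (x, false)] :> G.
Proof. exact: raag_inv_pi. Qed.

Lemma raag_ind (P : G -> Prop) : P 1%g ->
  (forall x g, P g -> P (raag_gen x * g)%g) ->
  (forall x g, P g -> P ((raag_gen x)^-1 * g)%g) -> forall g, P g.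
Proof.
move=> P1 Pgen Pinv; elim/quotW; elim=> [//|[x b] u Pu].
rewrite -cat1s -raag_mulE; case: b; first exact: Pgen.
by rewrite -raag_gen_inv; apply: Pinv.
Qed.

Lemma raag_invariant (T : Type) (F : G -> T) :
  (forall x g, F (raag_gen x * g)%g = F g) -> forall g, F g = F 1%g.
Proof.
move=> Fgen; apply: raag_ind => // x g <-; first exact: Fgen.
by rewrite -[in RHS](mulVKg (raag_gen x) g) Fgen.
Qed.

Section Action.
Variables (X : Type) (op : V * bool -> X -> X).
Hypothesis opV : forall x b z, op (x, b) (op (x, ~~ b) z) = z.
Hypothesis opC : forall x y z, E x y ->
  op (x, true) (op (y, true) z) = op (y, true) (op (x, true) z).

(** The word chosen by [repr] is immaterial: [opV] and [opC] are the defining relations of the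
    group. *)
Definition raag_act g z := foldr op z (repr g).

Lemma raag_act_pi u z : raag_act (\pi_(raag E) u) z = foldr op z u.
Proof.
suff cong_act u1 u2 : raag_cong E u1 u2 -> forall z, foldr op z u1 = foldr op z u2.
  exact/cong_act/raag_cong_repr.
elim=> //.
- by move=> u3 u4 u5 _ IH1 _ IH2 z'; rewrite IH1.
- by move=> u3 u4 u5 u6 _ IH1 _ IH2 z'; rewrite !foldr_cat IH2 IH1.
- by move=> x y xy z'; apply: opC.
Qed.

Lemma raag_act1 z : raag_act 1%g z = z.
Proof. by rewrite -[1%g]/(\pi_(raag E) [::] : G) raag_act_pi. Qed.

Lemma raag_act_gen x g z : raag_act (raag_gen x * g)%g z = op (x, true) (raag_act g z).
Proof. by elim/quotW: g => u; rewrite raag_mulE !raag_act_pi. Qed.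

Lemma raag_act_genV x g z :
  raag_act ((raag_gen x)^-1 * g)%g z = op (x, false) (raag_act g z).
Proof. by elim/quotW: g => u; rewrite raag_gen_inv raag_mulE !raag_act_pi. Qed.

End Action.

(** Let the letters act on [H] by left multiplication by their images; the orbit map of 1 is the
    homomorphism. *)
Lemma raag_universal (H : groupType) (phi : V -> H) :
    (forall x y, E x y -> commute (phi x) (phi y)) ->
  exists f : {multiplicative G -> H}, forall x, f (raag_gen x) = phi x.
Proof.
move=> phiC.
pose op (l : V * bool) (h : H) := ((if l.2 then phi l.1 else (phi l.1)^-1) * h)%g.
have opV x b z : op (x, b) (op (x, ~~ b) z) = z.
  by case: b; rewrite /op /= ?mulVKg ?mulKg.
have opC x y z : E x y -> op (x, true) (op (y, true) z) = op (y, true) (op (x, true) z).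
  by move=> /phiC xy; rewrite /op /= !mulgA xy.
have act_mul g z : raag_act op g z = (raag_act op g 1 * z)%g.
  elim/raag_ind: g z => [|x g IH|x g IH] z; first by rewrite !raag_act1 // mul1g.
    by rewrite !raag_act_gen // IH /op mulgA.
  by rewrite !raag_act_genV // IH /op mulgA.
have fM : {morph raag_act op ^~ 1%g : g h / g * h}%g.
  move=> g h; elim/raag_ind: g => [|x g IH|x g IH].
  - by rewrite raag_act1 // !mul1g.
  - by rewrite -mulgA !raag_act_gen // IH /op mulgA.
  - by rewrite -mulgA !raag_act_genV // IH /op mulgA.
pose F := raag_act op ^~ 1%g.
pose mF := isMultiplicative.Build G H F fM.
pose f : {multiplicative G -> H} := HB.pack F mF.
exists f => x; rewrite /= /F -[raag_gen x]mulg1 raag_act_gen // raag_act1 //.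
exact: mulg1.
Qed.

(* The cocycle condition on [psi] says that the letters of [U] act on [G * F_2]
   by [(g, n) |-> (x g, n + psi x g)], the other letters acting trivially.  The
   retraction [rho] onto the subgroup generated by [U] provides in each of its
   right cosets the base point [(rho g)^-1 g] from which to integrate. *)
Lemma raag_integrate (U : pred V) (psi : V -> G -> 'F_2) :
    (forall x y g, U x -> U y -> E x y ->
       psi y g + psi x (raag_gen y * g)%g = psi x g + psi y (raag_gen x * g)%g) ->
  exists phi : G -> 'F_2,
    forall x g, U x -> phi (raag_gen x * g)%g = phi g + psi x g.
Proof.
move=> psiC.
have [rho rho_gen] : exists f : {multiplicative G -> G},
    forall x, f (raag_gen x) = if U x then raag_gen x else 1%g.
  apply: raag_universal => x y xy.
  case: (U x); case: (U y); rewrite /commute ?mulg1 ?mul1g //.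
  exact: raag_gen_comm.
pose op (l : V * bool) (z : G * 'F_2) : G * 'F_2 :=
  if U l.1 then
    if l.2 then (raag_gen l.1 * z.1, z.2 + psi l.1 z.1)%g
    (* To undo the step from [x^-1 g] to [g], [psi] is evaluated at the new point [x^-1 g]; addition
       is its own inverse in F_2. *)
    else let g := ((raag_gen l.1)^-1 * z.1)%g in (g, z.2 + psi l.1 g)
  else z.
have opV x b z : op (x, b) (op (x, ~~ b) z) = z.
  case: z => g n; rewrite /op /=; case: ifP => [Ux|->] //.
  by case: b => /=; rewrite Ux /= ?mulVKg ?mulKg -addrA F2_addxx addr0.
have opC x y z : E x y -> op (x, true) (op (y, true) z) = op (y, true) (op (x, true) z).
  case: z => g n xy; rewrite /op /=; case Ux: (U x); case Uy: (U y) => //=.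
  rewrite !mulgA (raag_gen_comm xy); congr pair.
  by rewrite -!addrA psiC.
have act_fst g z : (raag_act op g z).1 = (rho g * z.1)%g.
  elim/raag_ind: g => [|x g IH|x g IH].
  - by rewrite raag_act1 // multiplicative1 mul1g.
  - rewrite raag_act_gen // gmulfM rho_gen /op /=; case: (U x) => /=.
      by rewrite IH mulgA.
    by rewrite mul1g.
  - rewrite raag_act_genV // gmulfM multiplicativeV rho_gen /op /=; case: (U x) => /=.
      by rewrite IH mulgA.
    by rewrite invg1 mul1g.
exists (fun g => (raag_act op g ((rho g)^-1 * g, 0)%g).2) => x g Ux.
have -> : ((rho (raag_gen x * g))^-1 * (raag_gen x * g) = (rho g)^-1 * g)%g.
  by rewrite gmulfM rho_gen Ux invgM -mulgA mulKg.
by rewrite raag_act_gen // {1}/op /= Ux /= act_fst /= mulVKg.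
Qed.

Implicit Types a b : {ffun V -> 'F_2}.

(** The homomorphism to F_2 with values [a] on the generators; exponents of letters are ignored
    because 1 = -1. *)
Definition raag_hom a g : 'F_2 := \sum_(l <- repr g) a l.1.

Lemma raag_hom_pi a u : raag_hom a (\pi_(raag E) u) = \sum_(l <- u) a l.1.
Proof.
suff cong_sum u1 u2 : raag_cong E u1 u2 ->
    \sum_(l <- u1) a l.1 = \sum_(l <- u2) a l.1.
  exact/cong_sum/raag_cong_repr.
elim=> //.
- by move=> u3 u4 u5 _ -> _ ->.
- by move=> u3 u4 u5 u6 _ IH1 _ IH2; rewrite !big_cat /= IH1 IH2.
- by move=> x b; rewrite !big_cons !big_nil addr0 F2_addxx.
- by move=> x y _; rewrite !big_cons !big_nil !addr0 addrC.
Qed.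

Lemma raag_homM a g h : raag_hom a (g * h)%g = raag_hom a g + raag_hom a h.
Proof.
by elim/quotW: g => u; elim/quotW: h => w; rewrite raag_mulE !raag_hom_pi big_cat.
Qed.

Lemma raag_hom1 a : raag_hom a 1%g = 0.
Proof. by rewrite -[1%g]/(\pi_(raag E) [::] : G) raag_hom_pi big_nil. Qed.

Lemma raag_hom_gen a x : raag_hom a (raag_gen x) = a x.
Proof. by rewrite raag_hom_pi big_seq1. Qed.

Lemma raag_homD a b g : raag_hom (a + b) g = raag_hom a g + raag_hom b g.
Proof. by rewrite -big_split; apply: eq_bigr => l _; rewrite ffunE. Qed.

End RaagGenerators.

Lemma raag_isomorphic (V V' : finType) (E : rel V) (E' : rel V') (p : V -> V') :
    bijective p -> (forall v w, E' (p v) (p w) = E v w) ->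
  group_isomorphic (raag E) (raag E').
Proof.
move=> [q pK qK] pE.
have [v w vw|f fE] := @raag_universal _ E (raag E') (fun v => raag_gen E' (p v)).
  by apply: raag_gen_comm; rewrite pE.
have [v w vw|f' f'E] := @raag_universal _ E' (raag E) (fun v => raag_gen E (q v)).
  by apply: raag_gen_comm; rewrite -pE !qK.
exists f; exists f' => g; elim/raag_ind: g => [|x g IH|x g IH];
  by rewrite ?multiplicative1 // !gmulfM ?multiplicativeV !(fE, f'E, pK, qK) IH.
Qed.

(** * Homogeneous cochains *)

Section Families.
Variable G : groupType.
Implicit Types (F k : G -> seq G -> 'F_2) (h : seq G -> 'F_2) (g x : G) (s t : seq G).

Lemma bar_diff_local h h' s :
  (forall t, (size t).+1 = size s -> h t = h' t) -> bar_diff h s = bar_diff h' s.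
Proof.
case: s => [//|x s] eq_h; rewrite /bar_diff.
congr (_ + _ + _); first exact: eq_h.
  by apply: eq_bigr => i _; apply: eq_h; rewrite size_bar_merge //= ltnS.
by apply: eq_h; rewrite size_belast.
Qed.

Lemma bar_diff0 s : bar_diff (fun=> 0 : 'F_2) s = 0 :> 'F_2.
Proof.
rewrite -[RHS](mul0r (bar_diff (fun=> 0 : 'F_2) s)) -bar_diffZ.
by apply: bar_diffE => t; rewrite mul0r.
Qed.

Lemma bar_diff_one s : bar_diff (@bar_one G) s = 0.
Proof. exact: (congr1 (fun a : cochain G => a s) (codiff1 G)). Qed.

(* Families [F] encode homogeneous cochains that need not be [G]-invariant:
   [F g [:: s_1; ...; s_n]] is the value at [(g, g s_1, ..., g s_1 ... s_n)], and
   [fdiff] is the homogeneous coboundary. *)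
Definition family_uncurry F s : 'F_2 := if s is g :: s' then F g s' else 0.

Definition fdiff F g s : 'F_2 :=
  bar_diff (family_uncurry F) (g :: s) + family_uncurry F s.

(** Only the first face moves the base point: [F g s] cancels the first face of [bar_diff (F g)],
    and [F (g * x) s] takes its place. *)
Lemma fdiff_cons F g x s :
  fdiff F g (x :: s) = F (g * x)%g s + F g s + bar_diff (F g) (x :: s).
Proof. by rewrite /fdiff bar_diff_cons /= -[RHS]addr0 -(F2_addxx (F x s)); ring. Qed.

Lemma fdiffE F F' : (forall g, F g =1 F' g) -> forall g, fdiff F g =1 fdiff F' g.
Proof.
move=> eqF g s; have eqU : family_uncurry F =1 family_uncurry F' by case.
by rewrite /fdiff (bar_diffE eqU) eqU.
Qed.

Lemma fdiffD F F' g s :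
  fdiff (fun g s => F g s + F' g s) g s = fdiff F g s + fdiff F' g s.
Proof.
have eqU : family_uncurry (fun g s => F g s + F' g s) =1
    (fun t => family_uncurry F t + family_uncurry F' t).
  by case=> //=; rewrite addr0.
by rewrite /fdiff (bar_diffE eqU) bar_diffD eqU addrACA.
Qed.

Lemma fdiff_shift F x g s : fdiff (fun g => F (x * g)%g) g s = fdiff F (x * g)%g s.
Proof.
case: s => [|y s]; last by rewrite !fdiff_cons mulgA.
by rewrite /fdiff !bar_diff1.
Qed.

Lemma fdiff_const h g s : fdiff (fun=> h) g s = bar_diff h s.
Proof.
case: s => [|x s]; last by rewrite fdiff_cons F2_addxx add0r.
by rewrite /fdiff bar_diff1 addr0.
Qed.

Lemma fdiff_fdiff F g s : fdiff (fdiff F) g s = 0.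
Proof.
pose U := family_uncurry F.
have eqU : family_uncurry (fdiff F) =1
    (fun t => bar_diff U t + family_uncurry (fun=> U) t).
  by case=> [|x t] //=; rewrite addr0.
rewrite {1}/fdiff (bar_diffE eqU) bar_diffD bar_diff_diff add0r eqU.
have := fdiff_const U g s; rewrite /fdiff => <-.
move: (bar_diff _ _) (family_uncurry _ _) => A T.
by rewrite -addrA F2_addxx addr0 F2_addxx.
Qed.

(** Without invariance the homogeneous complex is contractible: coning off with the vertex 1 is a
    homotopy, and only a constant in degree 0 survives. *)
Lemma fdiff_contract F : (forall g s, fdiff F g s = 0) -> forall g s,
  F g s = F 1%g [::] * bar_one s + fdiff (fun g s => F 1%g (g :: s)) g s.
Proof.
move=> DF g s; set H := fun g s => _.
have eqU : family_uncurry H =1 (fun t => F 1%g t + F 1%g [::] * bar_one t).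
  by case=> [|x t]; rewrite /= ?mulr1 ?F2_addxx // mulr0 addr0.
rewrite /fdiff (bar_diffE eqU) eqU bar_diffD bar_diffZ bar_diff_one mulr0 addr0.
have := DF 1%g (g :: s); rewrite fdiff_cons mul1g => eqF.
move: eqF; rewrite -addrA => /addr0_eq; rewrite F2_oppr => ->.
move: (F _ s) (bar_diff _ _) (F _ _ * _) => Y D C.
by rewrite [RHS]addrC -!addrA F2_addxx addr0 addrC.
Qed.

End Families.

(** * Degree one cocycles from homomorphisms to F_2 *)

Section HomCochain.
Variables (G : groupType) (e : G -> 'F_2).
Hypothesis eM : forall g h, e (g * h)%g = e g + e h.
Implicit Types (g : G) (s : seq G) (Q : seq G -> 'F_2).

Definition hom_cochain s : 'F_2 := if s is [:: g] then e g else 0.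

Let hom_cochain_hd g : (fun t => hom_cochain (g :: t)) =1 (fun t => e g * bar_one t).
Proof. by case=> [|x t]; rewrite /= ?mulr1 ?mulr0. Qed.

Lemma bar_cup_hom_cons Q g s : bar_cup hom_cochain Q (g :: s) = e g * Q s.
Proof.
rewrite bar_cup_cons mul0r add0r (bar_cupE (hom_cochain_hd g) (frefl Q)).
by rewrite bar_cupZl bar_cup1l.
Qed.

Lemma bar_cup_hom_nil Q : bar_cup hom_cochain Q [::] = 0.
Proof. by rewrite bar_cup_nil mul0r. Qed.

Lemma bar_diff_hom s : bar_diff hom_cochain s = 0.
Proof.
case: s => [|x [|y [|z s]]] //; first exact: bar_diff1.
  rewrite bar_diff_cons (bar_diffE (hom_cochain_hd x)) bar_diffZ bar_diff_one.
  by rewrite mulr0 addr0 /= eM addrCA F2_addxx addr0 F2_addxx.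
rewrite -[RHS](bar_diff0 [:: x, y, z & s]); apply: bar_diff_local.
by case=> [|t1 [|t2 t]].
Qed.

(** A Leibniz rule: as a family of degree 0, [e] has coboundary [hom_cochain]. Cup products of this
    class with cocycles thus become coboundaries of non-invariant families. *)
Lemma fdiff_mul_hom Q g s :
  fdiff (fun g s => e g * Q s) g s = bar_cup hom_cochain Q s + e g * bar_diff Q s.
Proof.
have eqU : family_uncurry (fun g s => e g * Q s) =1 bar_cup hom_cochain Q.
  by case=> [|x t] /=; rewrite ?bar_cup_hom_nil ?bar_cup_hom_cons.
rewrite /fdiff (bar_diffE eqU) bar_diff_cup eqU bar_cup_hom_cons addrC.
congr (_ + _); rewrite (bar_cupE bar_diff_hom (frefl Q)) /bar_cup.
by rewrite big1 ?add0r // => i _; rewrite mul0r.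
Qed.

Lemma hom_cochain_bounded : bar_bounded hom_cochain.
Proof. by exists 2%N => -[|x [|y s]]. Qed.

Let hom_cochain_cocycle : codiff (Cochain (asboolT hom_cochain_bounded)) == 0.
Proof. by apply/eqP/cochainP => s; apply: bar_diff_hom. Qed.

Definition hom_cocycle : cocycle G := Cocycle hom_cochain_cocycle.

Lemma hom_cocycleE s : hom_cocycle s = hom_cochain s.
Proof. by []. Qed.

End HomCochain.

Section Cocycles.
Variable G : groupType.
Implicit Types (y z : cocycle G) (s : seq G).

Lemma cocycle_ext y z : (forall s, y s = z s) -> y = z.
Proof. by move=> yz; apply/val_inj/cochainP. Qed.

Lemma cocycle0E s : (0 : cocycle G) s = 0.
Proof. by []. Qed.

Lemma cocycleDE y z s : (y + z) s = y s + z s.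
Proof. by []. Qed.

Lemma cocycleME y z s : (y * z) s = bar_cup y z s.
Proof. by []. Qed.

Lemma bar_diff_cocycle z s : bar_diff z s = 0.
Proof. exact: (congr1 (fun a : cochain G => a s) (codiff_cocycle z)). Qed.

(** The primitive [k] may be unbounded: its coboundary vanishes in high degrees, so it can be
    truncated. *)
Lemma cohomology_eq y z (k : seq G -> 'F_2) :
  (forall s, y s = z s + bar_diff k s) -> \pi_(cohomology G) y = \pi_(cohomology G) z.
Proof.
move=> eq_yz; have [n yz_bd] := cochain_bounded (val y - val z).
have diff_k s : (n <= size s)%N -> bar_diff k s = 0.
  by move=> /yz_bd; rewrite -[X in X = _ -> _]/(y s - z s) eq_yz addrC addKr.
pose h s := if (size s < n)%N then k s else 0.
have h_bd : bar_bounded h by exists n => s; rewrite /h leqNgt; case: ifP.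
apply/cohomology_eqP/asboolP; exists (Cochain (asboolT h_bd)).
apply: cochainP => s; transitivity (bar_diff k s).
  by rewrite -[LHS]/(y s - z s) eq_yz addrC addKr.
have [le_s|lt_n] := leqP (size s) n.
  by apply: bar_diff_local => t eq_t; rewrite /= /h eq_t le_s.
rewrite diff_k ?(ltnW lt_n) // -[LHS](bar_diff0 s); apply: bar_diff_local => t eq_t.
by rewrite /= /h ltnNge -ltnS eq_t lt_n.
Qed.

Lemma cohomology_repr z : exists a : cochain G, forall s,
  repr (\pi_(cohomology G) z) s = z s + bar_diff a s.
Proof.
have : \pi_(cohomology G) (repr (\pi_(cohomology G) z)) = \pi_(cohomology G) z.
  exact: reprK.
move=> /cohomology_eqP/asboolP[a eq_a]; exists a => s.
by rewrite addrC -[bar_diff a s]/(codiff a s) -eq_a; apply/esym/subrK.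
Qed.

Lemma cohomology_piD y z : \pi_(cohomology G) (y + z) =
  \pi_(cohomology G) y + \pi_(cohomology G) z :> cohomology G.
Proof. exact/esym/cohomology_add_pi. Qed.

Lemma cohomology_piM y z : \pi_(cohomology G) (y * z) =
  \pi_(cohomology G) y * \pi_(cohomology G) z :> cohomology G.
Proof. exact/esym/cohomology_mul_pi. Qed.

Lemma cohomology_pi1 : \pi_(cohomology G) 1 = 1 :> cohomology G.
Proof. by []. Qed.

Lemma cohomology_pi0 : \pi_(cohomology G) 0 = 0 :> cohomology G.
Proof. by rewrite piE. Qed.

End Cocycles.

(** * The cohomology ring of a right-angled Artin group *)

Section Functionals.
Variable G : groupType.
Implicit Types (x y : cohomology G) (z : cocycle G) (g h : G).

Definition coh_aug x : 'F_2 := repr x [::].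
Definition coh_lin x g : 'F_2 := repr x [:: g].
(** For commuting [g] and [h] this evaluates a class on the image of the fundamental class of a
    torus; only then is it independent of the representative. *)
Definition coh_alt x g h : 'F_2 := repr x [:: g; h] + repr x [:: h; g].

Lemma coh_aug_pi z : coh_aug (\pi_(cohomology G) z) = z [::].
Proof. by have [a eq_a] := cohomology_repr z; rewrite /coh_aug eq_a addr0. Qed.

Lemma coh_lin_pi z g : coh_lin (\pi_(cohomology G) z) g = z [:: g].
Proof. by have [a eq_a] := cohomology_repr z; rewrite /coh_lin eq_a bar_diff1 addr0. Qed.

Lemma coh_alt_pi z g h : commute g h ->
  coh_alt (\pi_(cohomology G) z) g h = z [:: g; h] + z [:: h; g].
Proof.
move=> gh; have [a eq_a] := cohomology_repr z; rewrite /coh_alt !eq_a addrACA.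
rewrite !bar_diff_cons gh !bar_diff1 !addr0 -[RHS]addr0; congr (_ + _).
move: (a _) (a _) (a _) => A B C.
transitivity (A + A + (B + B) + (C + C)); first by ring.
by rewrite !F2_addxx ?addr0.
Qed.

Lemma coh_augD x y : coh_aug (x + y) = coh_aug x + coh_aug y.
Proof.
elim/quotW: x => y1; elim/quotW: y => y2.
by rewrite -cohomology_piD !coh_aug_pi.
Qed.

Lemma coh_linD x y g : coh_lin (x + y) g = coh_lin x g + coh_lin y g.
Proof.
elim/quotW: x => y1; elim/quotW: y => y2.
by rewrite -cohomology_piD !coh_lin_pi.
Qed.

Lemma coh_aug0 : coh_aug 0 = 0.
Proof. by rewrite -cohomology_pi0 coh_aug_pi. Qed.

Lemma coh_lin0 g : coh_lin 0 g = 0.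
Proof. by rewrite -cohomology_pi0 coh_lin_pi. Qed.

Lemma coh_alt0 g h : commute g h -> coh_alt 0 g h = 0.
Proof. by move=> gh; rewrite -cohomology_pi0 coh_alt_pi // !cocycle0E addr0. Qed.

Lemma coh_aug1 : coh_aug 1 = 1.
Proof. by rewrite -cohomology_pi1 coh_aug_pi. Qed.

Lemma coh_lin1 g : coh_lin 1 g = 0.
Proof. by rewrite -cohomology_pi1 coh_lin_pi. Qed.

Lemma coh_augM x y : coh_aug (x * y) = coh_aug x * coh_aug y.
Proof.
elim/quotW: x => y1; elim/quotW: y => y2.
by rewrite -cohomology_piM !coh_aug_pi cocycleME bar_cup_nil.
Qed.

Lemma coh_linM x y g :
  coh_lin (x * y) g = coh_aug x * coh_lin y g + coh_lin x g * coh_aug y.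
Proof.
elim/quotW: x => y1; elim/quotW: y => y2.
by rewrite -cohomology_piM !coh_lin_pi !coh_aug_pi cocycleME bar_cup_cons bar_cup_nil.
Qed.

(** The vanishing augmentations remove the products of components of degrees 0 and 2. *)
Lemma coh_altM x y g h : commute g h -> coh_aug x = 0 -> coh_aug y = 0 ->
  coh_alt (x * y) g h = coh_lin x g * coh_lin y h + coh_lin x h * coh_lin y g.
Proof.
move=> gh; elim/quotW: x => y1; elim/quotW: y => y2.
rewrite -cohomology_piM !coh_lin_pi !coh_aug_pi coh_alt_pi // !cocycleME => y10 y20.
by rewrite !bar_cup_cons !bar_cup_nil y10 y20 !mul0r !mulr0 !addr0 !add0r.
Qed.

End Functionals.

Section RaagCohomology.
Variables (V : finType) (E : rel V).
Hypothesis E_sym : symmetric E.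
Local Notation G := (raag E).
Local Notation H := (cohomology G).
Implicit Types (a b : {ffun V -> 'F_2}) (g h : G) (s : seq G) (z : cocycle G).

Definition raag_cocycle a : cocycle G := hom_cocycle (@raag_homM _ E a).

Definition raag_class a : H := \pi_H (raag_cocycle a).

(** Stated on cocycles and not on classes because the induction below compares families
    pointwise. *)
Inductive raag_cocycle_gen : cocycle G -> Prop :=
| RaagCocycle0 : raag_cocycle_gen 0
| RaagCocycle1 : raag_cocycle_gen 1
| RaagCocycleD y z :
    raag_cocycle_gen y -> raag_cocycle_gen z -> raag_cocycle_gen (y + z)
| RaagCocycleM a z : raag_cocycle_gen z -> raag_cocycle_gen (raag_cocycle a * z).

Definition left_invariant (S : seq V) (F : G -> seq G -> 'F_2) :=
  forall x, x \in S -> forall g s, F (raag_gen E x * g)%g s = F g s.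

(* The families invariant under the generators in [S] compute the cohomology of
   the subgroup they generate.  In the induction step, from [S] to [v :: S],
   the increment of such a family under [v] is invariant under the link of [v]
   in [S], and every such family is an increment by [raag_integrate]; the
   connecting map of the resulting exact sequence is the product with the
   class of [v]. *)
Lemma raag_invariant_cocycle (S : seq V) (F : G -> seq G -> 'F_2) :
    uniq S -> left_invariant S F -> (forall g s, fdiff F g s = 0) ->
  exists z k, [/\ raag_cocycle_gen z, left_invariant S k
    & forall g s, F g s = z s + fdiff k g s].
Proof.
have [n] := ubnP (size S); elim: n S F => // n IHn [|v S] F.
  move=> _ _ _ DF; have eqF := fdiff_contract DF.
  exists (if F 1%g [::] == 0 then 0 else 1), (fun g s => F 1%g (g :: s)).
  split=> // [|g s]; first by case: ifP => _; constructor.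
  rewrite eqF; congr (_ + _); have [->|/F2_neq0->] := eqVneq (F 1%g [::]) 0.
    by rewrite mul0r.
  by rewrite mul1r.
rewrite /= ltnS => lt_n /andP[vS uniqS] invF DF.
have [x xS|z [k [genz invk eqF]]] := IHn S F lt_n uniqS _ DF.
  by apply: invF; rewrite inE xS orbT.
pose gv := raag_gen E v; pose L := [seq x <- S | E v x].
pose K g s := k (gv * g)%g s + k g s.
have invK : left_invariant L K.
  move=> x; rewrite mem_filter => /andP[vx xS] g s.
  by rewrite /K mulgA (raag_gen_comm vx) -mulgA !(invk x).
have DK g s : fdiff K g s = 0.
  rewrite fdiffD fdiff_shift; apply: (addrI (z s)); rewrite addrA -eqF.
  by rewrite invF ?mem_head // eqF -addrA F2_addxx addr0.
have lt_L : (size L < n)%N.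
  by apply: leq_ltn_trans lt_n; rewrite size_filter count_size.
have [y [l [geny invl eqK]]] := IHn L K lt_L (filter_uniq _ uniqS) invK DK.
(* For each [s], [l] is integrated to a function with increment [l] under [v] and none under [S].
   The condition on an edge from [v] to [S] is the invariance of [l] under the link. *)
have /choice[m mE] s : exists m : G -> 'F_2, forall x g, x \in v :: S ->
    m (raag_gen E x * g)%g = m g + (if x == v then l g s else 0).
  apply: (@raag_integrate _ E [in v :: S] (fun x g => if x == v then l g s else 0)).
  move=> x x' g /= xS x'S xx'; rewrite !inE in xS x'S.
  have [eq_x|ne_x] := eqVneq x v; have [eq_x'|ne_x'] := eqVneq x' v => //.
  - by rewrite eq_x eq_x'.
  - rewrite (negPf ne_x') /= in x'S; rewrite invl ?addr0 ?add0r //.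
    by rewrite mem_filter x'S -eq_x xx'.
  - rewrite (negPf ne_x) /= in xS; rewrite invl ?addr0 ?add0r //.
    by rewrite mem_filter xS -eq_x' E_sym xx'.
pose M g s := m s g.
have M_v g s : M (gv * g)%g s + M g s = l g s.
  by rewrite /M mE ?mem_head // eqxx addrAC F2_addxx add0r.
have invM : left_invariant S M.
  move=> x xS g s; rewrite /M mE ?inE ?xS ?orbT //.
  by case: eqP xS vS => [-> ->|_ _ _] //; rewrite addr0.
pose e := raag_hom (delta v) : G -> 'F_2.
(* Under [v], [k + fdiff M] changes by [y], and so does [e * y] because [e] grows by 1; the sum is
   invariant. The coboundary of [e * y] is the added product. *)
exists (z + raag_cocycle (delta v) * y).
exists (fun g s => k g s + fdiff M g s + e g * y s); split.
- by apply: RaagCocycleD => //; apply: RaagCocycleM.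
- move=> x; rewrite inE; case/orP => [/eqP->|xS] g s.
    rewrite -/gv; have := eqK g s; rewrite /K => /(canRL (addrK _)) ->.
    have : fdiff M (gv * g)%g s + fdiff M g s = fdiff l g s.
      by rewrite -fdiff_shift -fdiffD; apply: fdiffE => g' s'; apply: M_v.
    move/(canRL (addrK _)) ->; rewrite /e raag_homM raag_hom_gen ffunE eqxx.
    rewrite mulrDl mul1r !F2_oppr.
    move: (y s) (fdiff l g s) (k g s) (fdiff M g s) (_ * _) => a b c d f.
    transitivity (c + d + f + (a + a) + (b + b)); first by ring.
    by rewrite !F2_addxx ?addr0.
  have ne_x : x != v by apply: contraNneq vS => <-.
  rewrite invk // /e raag_homM raag_hom_gen ffunE (negPf ne_x) add0r.
  congr (_ + _ + _); rewrite -fdiff_shift; apply: fdiffE => g' s'.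
  exact: invM.
- move=> g s; rewrite (fdiffD (fun g s => k g s + fdiff M g s)) (fdiffD k (fdiff M)).
  rewrite fdiff_fdiff addr0 fdiff_mul_hom.
    rewrite bar_diff_cocycle mulr0 addr0 eqF cocycleDE addrACA cocycleME.
    by rewrite F2_addxx addr0.
  exact: raag_homM.
Qed.

(** A cocycle is a constant family, and a primitive invariant under all vertices is constant too,
    hence an ordinary cochain, possibly unbounded. *)
Lemma raag_cohomology_ind (P : H -> Prop) : P 0 -> P 1 ->
    (forall x y, P x -> P y -> P (x + y)) ->
    (forall a x, P x -> P (raag_class a * x)) ->
  forall x, P x.
Proof.
move=> P0 P1 PD PM; elim/quotW=> z.
have [||g s|y [k [geny invk eqz]]] :=
  @raag_invariant_cocycle (enum V) (fun=> val z).
- exact: enum_uniq.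
- by move=> x _ g s.
- by rewrite fdiff_const bar_diff_cocycle.
have {}eqz s : z s = y s + bar_diff (k 1%g) s.
  have k_const g : k g = k 1%g.
    by apply: raag_invariant => x h; apply: funext => t; rewrite invk ?mem_enum.
  rewrite (eqz 1%g) -(fdiff_const _ 1%g); congr (_ + _); apply: fdiffE => g t.
  by rewrite k_const.
rewrite (cohomology_eq eqz).
elim: {z k invk eqz} geny => [||y1 y2 _ Py1 _ Py2|a z _ Pz].
- by rewrite cohomology_pi0.
- by rewrite cohomology_pi1.
- by rewrite cohomology_piD; apply: PD.
- by rewrite cohomology_piM; apply: PM.
Qed.

Lemma raag_classD a b : raag_class (a + b) = raag_class a + raag_class b.
Proof.
rewrite -cohomology_piD; apply: (@cohomology_eq _ _ _ (fun=> 0)) => s.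
rewrite bar_diff0 addr0 cocycleDE !hom_cocycleE.
by case: s => [|g [|h s]] /=; rewrite ?addr0 // raag_homD.
Qed.

Lemma coh_aug_class a : coh_aug (raag_class a) = 0.
Proof. exact: coh_aug_pi. Qed.

Lemma coh_lin_class a v : coh_lin (raag_class a) (raag_gen E v) = a v.
Proof. by rewrite coh_lin_pi hom_cocycleE /= raag_hom_gen. Qed.

(** Perpendicularity is the integrability condition for [a x * raag_hom b g], and the integral [phi]
    yields a primitive of the cup product. *)
Lemma raag_class_mul0 a b : perp E a b -> raag_class a * raag_class b = 0.
Proof.
move=> /perpP ab.
have [x y g _ _ xy|phi phiE] := @raag_integrate _ E predT (fun x g => a x * raag_hom b g).
  rewrite !raag_homM !raag_hom_gen !mulrDr addrCA addrA (ab _ _ xy).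
  by rewrite [RHS]addrCA [RHS]addrA addrAC addrC addrA; congr (_ + _ + _); rewrite mulrC.
(* The left side is invariant in [g] under the generators, so it equals its value at [g = 1]. *)
have phiM g h : phi (g * h)%g + phi g + raag_hom a g * raag_hom b h = phi h + phi 1%g.
  pose f g := phi (g * h)%g + phi g + raag_hom a g * raag_hom b h.
  rewrite -[LHS]/(f g) (raag_invariant (F := f)); last first.
    move=> x {}g; rewrite /f -mulgA !phiE // !raag_homM raag_hom_gen.
    rewrite mulrDl mulrDr.
    move: (phi _) (phi _) (_ * _) (_ * _) (_ * _) => A B C D F.
    transitivity (B + A + C + (D + D) + (F + F)); first by ring.
    by rewrite !F2_addxx ?addr0.
  by rewrite /f mul1g raag_hom1 mul0r addr0.
rewrite -cohomology_piM -cohomology_pi0.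
(* The three copies of [phi 1] in the coboundary of [q] add up to the one in [phiM]. *)
pose q s := if s is [:: g] then phi g + phi 1%g else 0.
apply: (@cohomology_eq _ _ _ q) => s; rewrite cocycle0E add0r cocycleME.
case: s => [|g [|h [|h' s]]].
- by rewrite bar_cup_hom_nil.
- by rewrite bar_diff1 bar_cup_hom_cons mulr0.
- rewrite bar_cup_hom_cons bar_diff_cons bar_diff1 addr0 /=.
  have := phiM g h; rewrite addrC => /(canRL (addrK _)) ->; rewrite F2_oppr.
  move: (phi _) (phi _) (phi _) (phi _) => A B C D.
  transitivity (A + B + C + D + (C + C)); last by ring.
  by rewrite F2_addxx addr0; ring.
- rewrite bar_cup_hom_cons mulr0 -[LHS](bar_diff0 [:: g, h, h' & s]).
  by apply: bar_diff_local => -[|x [|y t]].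
Qed.

End RaagCohomology.

(** * Ring isomorphisms in degree one *)

Section DegreeOnePart.
Variables (V V' : finType) (E : rel V) (E' : rel V').
Hypothesis E_sym : symmetric E.
Variable phi : {rmorphism cohomology (raag E) -> cohomology (raag E')}.
Implicit Types (a b : {ffun V -> 'F_2}).

Definition degree1_part a : {ffun V' -> 'F_2} :=
  [ffun u => coh_lin (phi (raag_class E a)) (raag_gen E' u)].

Lemma degree1_part_is_zmod_morphism : zmod_morphism degree1_part.
Proof.
move=> a b; apply: (canRL (addrK _)); apply/ffunP => u.
by rewrite !ffunE -coh_linD -rmorphD -raag_classD subrK.
Qed.

HB.instance Definition _ := GRing.isZmodMorphism.Build _ _ degree1_part
  degree1_part_is_zmod_morphism.

(** Degree one classes square to zero, so the augmentation of the image squares to zero in a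
    field. *)
Lemma coh_aug_morph_class a : coh_aug (phi (raag_class E a)) = 0.
Proof.
have aa0 : raag_class E a * raag_class E a = 0 by apply/raag_class_mul0/perp_refl.
have := congr1 (fun x => coh_aug (phi x)) aa0.
rewrite rmorphM rmorph0 coh_aug0 coh_augM => /eqP.
by rewrite mulf_eq0 orbb => /eqP.
Qed.

(* A ring isomorphism need not be graded; but since the cohomology is generated
   in degree one, it induces on degree one parts the map [degree1_part]. *)
Lemma coh_lin_morph x u : coh_lin (phi x) (raag_gen E' u) =
  degree1_part [ffun v => coh_lin x (raag_gen E v)] u.
Proof.
(* The product case also needs [phi] to preserve augmentations, so both claims are proved
   together. *)
suff [] : coh_aug (phi x) = coh_aug x /\ forall u, coh_lin (phi x) (raag_gen E' u) =
  degree1_part [ffun v => coh_lin x (raag_gen E v)] u by [].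
have lin_ffun0 y : (forall g, coh_lin y g = 0) ->
    [ffun v => coh_lin y (raag_gen E v)] = 0.
  by move=> y0; apply/ffunP => v; rewrite !ffunE.
elim/(raag_cohomology_ind E_sym): x {u} => [||x y [augx linx] [augy liny]|a x [augx _]].
- rewrite rmorph0 !coh_aug0; split=> // u; rewrite lin_ffun0 => [|g].
    by rewrite raddf0 coh_lin0 ffunE.
  exact: coh_lin0.
- rewrite rmorph1 !coh_aug1; split=> // u; rewrite lin_ffun0 => [|g].
    by rewrite raddf0 coh_lin1 ffunE.
  exact: coh_lin1.
- rewrite rmorphD !coh_augD augx augy; split=> // u; rewrite coh_linD linx liny.
  have -> : [ffun v => coh_lin (x + y) (raag_gen E v)] =
      [ffun v => coh_lin x (raag_gen E v)] + [ffun v => coh_lin y (raag_gen E v)].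
    by apply/ffunP => v; rewrite !ffunE coh_linD.
  by rewrite raddfD [RHS]ffunE.
(* Only the degree 0 component of [x] contributes: the degree one part of the product is [a] times
   [coh_aug x]. *)
- rewrite rmorphM !coh_augM coh_aug_morph_class coh_aug_class !mul0r; split=> // u.
  rewrite coh_linM coh_aug_morph_class mul0r add0r augx.
  have -> : [ffun v => coh_lin (raag_class E a * x) (raag_gen E v)] =
      [ffun v => a v * coh_aug x].
    by apply/ffunP => v; rewrite !ffunE coh_linM coh_aug_class mul0r add0r coh_lin_class.
  have [->|/F2_neq0->] := eqVneq (coh_aug x) 0.
    rewrite mulr0 (_ : [ffun v => a v * 0] = 0) ?raddf0 ?ffunE //.
    by apply/ffunP => v; rewrite !ffunE mulr0.
  rewrite mulr1 (_ : [ffun v => a v * 1] = a) ?ffunE //.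
  by apply/ffunP => v; rewrite !ffunE mulr1.
Qed.

(** On each edge [u w], the vanishing product is evaluated on the torus of the two commuting
    generators. *)
Lemma degree1_part_perp a b :
  perp E a b -> perp E' (degree1_part a) (degree1_part b).
Proof.
move=> /(raag_class_mul0) ab; apply/perpP => u w /(raag_gen_comm) uw.
have := congr1 (fun x => coh_alt (phi x) (raag_gen E' u) (raag_gen E' w)) ab.
rewrite rmorphM rmorph0 coh_alt0 // coh_altM ?coh_aug_morph_class // !ffunE.
by move=> /addr0_eq; rewrite F2_oppr.
Qed.

End DegreeOnePart.

(** [coh_lin_morph] for [psi] applies to the whole image under [phi], whatever its components in
    other degrees. *)
Lemma degree1_partK (V V' : finType) (E : rel V) (E' : rel V')
    (phi : {rmorphism cohomology (raag E) -> cohomology (raag E')})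
    (psi : {rmorphism cohomology (raag E') -> cohomology (raag E)}) :
    symmetric E' -> cancel phi psi ->
  cancel (degree1_part phi) (degree1_part psi).
Proof.
move=> E'_sym phiK a; apply/ffunP => v.
transitivity (coh_lin (psi (phi (raag_class E a))) (raag_gen E v)).
  exact/esym/coh_lin_morph.
by rewrite phiK coh_lin_class.
Qed.

(** * Functoriality *)

Section Pullback.
Variables (G H : groupType) (f : {multiplicative G -> H}).
Implicit Types (h : seq H -> 'F_2) (s : seq G).

Lemma map_bar_merge i s : map f (bar_merge i s) = bar_merge i (map f s).
Proof.
have f_nth j : nth 1%g (map f s) j = f (nth 1%g s j).
  have [lt_j|le_j] := ltnP j (size s); first exact: nth_map.
  by rewrite !nth_default ?size_map // multiplicative1.
by rewrite /bar_merge map_cat /= map_take map_drop gmulfM !f_nth.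
Qed.

Lemma bar_diff_pullback h s :
  bar_diff (fun t => h (map f t)) s = bar_diff h (map f s).
Proof.
case: s => [//|x s]; rewrite /bar_diff /= size_map; congr (_ + _ + _).
  by apply: eq_bigr => i _; rewrite map_bar_merge.
by congr h; elim: s x => //= y s IHs x; rewrite IHs.
Qed.

Lemma bar_cup_pullback h h' s :
  bar_cup (fun t => h (map f t)) (fun t => h' (map f t)) s = bar_cup h h' (map f s).
Proof.
by rewrite /bar_cup size_map; apply: eq_bigr => i _; rewrite map_take map_drop.
Qed.

Lemma bar_bounded_pullback h : bar_bounded h -> bar_bounded (fun s => h (map f s)).
Proof. by move=> [n h0]; exists n => s le_s; apply: h0; rewrite size_map. Qed.

Definition cochain_pullback (a : cochain H) : cochain G :=
  Cochain (asboolT (bar_bounded_pullback (cochain_bounded a))).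

Lemma codiff_pullback a : codiff (cochain_pullback a) = cochain_pullback (codiff a).
Proof. by apply: cochainP => s; apply: bar_diff_pullback. Qed.

Lemma cocycle_pullback_subproof (z : cocycle H) :
  codiff (cochain_pullback (val z)) == 0.
Proof.
by rewrite codiff_pullback codiff_cocycle; apply/eqP/cochainP.
Qed.

Definition cocycle_pullback (z : cocycle H) : cocycle G :=
  Cocycle (cocycle_pullback_subproof z).

Definition coh_pullback (x : cohomology H) : cohomology G :=
  \pi_(cohomology G) (cocycle_pullback (repr x)).

Lemma coh_pullback_pi z :
  coh_pullback (\pi_(cohomology H) z) = \pi_(cohomology G) (cocycle_pullback z).
Proof.
have [a eq_a] := cohomology_repr z.
apply: (@cohomology_eq _ _ _ (fun s => a (map f s))) => s.
by rewrite bar_diff_pullback; apply: eq_a.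
Qed.

Lemma coh_pullbackD (x y : cohomology H) :
  coh_pullback (x + y) = coh_pullback x + coh_pullback y.
Proof.
elim/quotW: x => x; elim/quotW: y => y.
rewrite -(cohomology_piD x y) !coh_pullback_pi -cohomology_piD; congr (\pi _).
exact: cocycle_ext.
Qed.

Lemma coh_pullback_is_zmod_morphism : zmod_morphism coh_pullback.
Proof.
by move=> x y; apply: (canRL (addrK _)); rewrite -coh_pullbackD subrK.
Qed.

Lemma coh_pullback_is_monoid_morphism : monoid_morphism coh_pullback.
Proof.
split=> [|x y].
  rewrite -cohomology_pi1 coh_pullback_pi; congr (\pi _).
  by apply: cocycle_ext => -[].
elim/quotW: x => x; elim/quotW: y => y.
rewrite -(cohomology_piM x y) !coh_pullback_pi -cohomology_piM; congr (\pi _).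
by apply: cocycle_ext => s; apply/esym/bar_cup_pullback.
Qed.

HB.instance Definition _ := GRing.isZmodMorphism.Build _ _ coh_pullback
  coh_pullback_is_zmod_morphism.
HB.instance Definition _ := GRing.isMonoidMorphism.Build _ _ coh_pullback
  coh_pullback_is_monoid_morphism.

End Pullback.

Lemma coh_pullbackK (G H : groupType) (f : {multiplicative G -> H})
    (f' : {multiplicative H -> G}) :
  cancel f f' -> cancel (coh_pullback f') (coh_pullback f).
Proof.
move=> fK; elim/quotW=> z; rewrite (coh_pullback_pi f') coh_pullback_pi; congr (\pi _).
by apply: cocycle_ext => s /=; rewrite mapK.
Qed.

Lemma group_isomorphic_can (G H : groupType) :
  group_isomorphic G H -> exists (f : {multiplicative G -> H})
    (f' : {multiplicative H -> G}), cancel f f' /\ cancel f' f.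
Proof.
move=> [f [f' fK f'K]].
pose m := isMultiplicative.Build H G f' (can2_gmulfM fK f'K).
by exists f, (HB.pack_for {multiplicative H -> G} f' m); split.
Qed.

Theorem theorem8p3 (V V' : finType) (E : rel V) (E' : rel V')
    (E_sym : symmetric E) (E_irrefl : irreflexive E)
    (E'_sym : symmetric E') (E'_irrefl : irreflexive E') :
  group_isomorphic (raag E) (raag E') <->
  ring_isomorphic (cohomology (raag E)) (cohomology (raag E')).
Proof.
split=> [/group_isomorphic_can[f [f' [fK f'K]]]|[phi [psi' phiK psi'K]]].
  (* Pullback is contravariant, so the inverse [f'] induces the map in the required direction. *)
  by exists (coh_pullback f'), (coh_pullback f); apply: coh_pullbackK.
pose mZ := GRing.isZmodMorphism.Build _ _ psi' (can2_zmod_morphism phiK psi'K).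
pose mM := GRing.isMonoidMorphism.Build _ _ psi' (can2_monoid_morphism phiK psi'K).
pose psi := HB.pack_for
  {rmorphism cohomology (raag E') -> cohomology (raag E)} psi' mZ mM.
have [p p_bij pE] := graph_rigidity E_sym E_irrefl E'_sym E'_irrefl
  (degree1_partK (phi := phi) (psi := psi) E'_sym phiK)
  (degree1_partK (phi := psi) (psi := phi) E_sym psi'K)
  (@degree1_part_perp _ _ _ _ phi) (@degree1_part_perp _ _ _ _ psi).
exact: raag_isomorphic p_bij pE.
Qed.
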